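(* Let $n\ge 1$ and let $a_1,\dots,a_n$ be nonnegative integers. For the diagrams $VT(a_1,\dots,a_n)$ and $VT(p(a_1),\dots,p(a_n))$, $$\overline{\Delta}_0(VT(a_1,\dots,a_n))(u,v)=(-uv)^{\sum_{i=1}^{n}\lfloor a_i/2\rfloor}\left(\overline{\Delta}_0(VT(p(a_1),\dots,p(a_n)))(u,v)+\sum_{i=1}^{n}\left\lfloor\frac{a_i}{2}\right\rfloor(-1)^{\delta+s(n)}(uv)^{\varepsilon(i)}\right)$$ as an identity in $\mathbb{Z}[u^{\pm1},v^{\pm1}]$, where $s,\delta,\varepsilon$ are computed from $(a_1,\dots,a_n)$.
   Context: Notation. For an integer $k$, $p(k)=0$ if $k$ is even and $p(k)=1$ if $k$ is odd. For integers $a_1,\dots,a_n$: $s(0)=0$, $s(i)=\sum_{j=1}^{i}(a_j+1)$, $\delta=\sum_{j=1}^n p(a_j)p(s(j))$, and $\varepsilon(i)=(p(s(i-1))-1)+\sum_{j<i}p(a_j)p(s(j))+\sum_{j\ge i}p(a_j)p(1+s(j-1))$. Alexander matrix. An oriented virtual link diagram has classical crossings (with over/under information and a sign $\pm$) and virtual crossings. An arc runs from one classical crossing to the next classical crossing, ignoring virtual crossings; a diagram $D$ with $N'$ classical crossings has $2N'$ arcs, which are given a fixed order. At a classical crossing let $\omega,\omega'$ be the incoming and outgoing arcs of the over strand and $\nu,\nu'$ the incoming and outgoing arcs of the under strand. A positive crossing gives the two relations $\nu-\omega'-u\nu'+u\omega=0$ and $v\omega'-\omega=0$ (in this order); a negative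 crossing gives $\omega-\nu'-u\omega'+u\nu=0$ and $v\omega-\omega'=0$ (in this order). (If arcs coincide, coefficients are added.) The $2N'\times 2N'$ coefficient matrix (a consecutive pair of rows per crossing, columns indexed by the arcs in order) is the Alexander matrix, and $\Delta_0(D)(u,v)\in\mathbb{Z}[u,v]$ is its determinant. (The order of the crossings does not affect the determinant.) Virtual twist knot diagram $VT(a_1,\dots,a_n)$, for integers $a_i$. Two strands are twisted horizontally in $n$ blocks from left to right; block $i$ has $|a_i|$ classical crossings, all with the sign of $a_i$; consecutive blocks are separated by one virtual crossing; the ends are closed up by a clasp consisting of one classical and one virtual crossing. Put $N=\sum|a_i|$. The classical crossings are $c_1$ (clasp) and $c_2,\dots,c_{N+1}$ (the twist, left to right); the ordered arcs are $x_1,\dots,x_{2N+2}$. At $c_{k+1}$ ($1\le k\le N$) the odd strand passes from $x_{2k-1}$ to $x_{2k+1}$ and the even strand passes from $x_{2k+2}$ to $x_{2k}$. If $c_{k+1}$ is the $r$-th crossing of block $i$, it is of type 1 if $s(i-1)+r-1$ is even (an even number of classical and virtual crossings precede it in the twist) and of type 2 otherwise. In positive type 1 and negative type 2 crossings the even strand is over; in negative type 1 and positive type 2 crossings the odd strand is over. At $c_1$ the over strand passes from $x_2$ to $x_1$, the under strand passes from $x_{2N+1}$ to $x_{2N+2}$, and the sign is positive if $s(n)$ is even and negative if $s(n)$ is odd. For a diagram $D$ of a virtual knot, $(u-1)(v-1)(uv-1)$ divides $\Delta_0(D)(u,v)$ (Silver–Williams), and $\overline{\Delta}_0(D)$ denotes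 the quotient: $\Delta_0(D)=(u-1)(v-1)(uv-1)\overline{\Delta}_0(D)$. Polynomials here are those of the specific labeled diagrams, not normalized. *)

(* Defs.v *)
From HB Require Import structures.
From mathcomp Require Import all_boot all_order all_algebra.

Set Implicit Arguments.
Unset Strict Implicit.
Unset Printing Implicit Defensive.

Import Order.TTheory GRing.Theory Num.Theory.
Local Open Scope ring_scope.

(* Z[u, v] is {poly {poly int}} with u the outer variable. The ring of Laurent
   polynomials Z[u^+-1, v^+-1] is regarded as a subring of the field Frac. *)
Notation Zuv := {poly {poly int}}.
Notation Frac := {fraction Zuv}.

Definition pu : Zuv := 'X.
Definition pv : Zuv := 'Y.
Definition fu : Frac := tofrac pu.
Definition fv : Frac := tofrac pv.

(* The indices i of s, eps and of the entries a_i are 1-based: a_i = a`_i.-1. *)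

Definition p (k : int) : int := (k %% 2)%Z.

Definition s (a : seq int) (i : nat) : int :=
  \sum_(1 <= j < i.+1) (a`_j.-1 + 1).

Definition delta (a : seq int) : int :=
  \sum_(1 <= j < (size a).+1) p a`_j.-1 * p (s a j).

Definition eps (a : seq int) (i : nat) : int :=
  (p (s a i.-1) - 1)
  + \sum_(1 <= j < i) p a`_j.-1 * p (s a j)
  + \sum_(i <= j < (size a).+1) p a`_j.-1 * p (1 + s a j.-1).

(* Only the classical crossings are recorded, each with its sign and the four
   arcs meeting there; virtual crossings do not affect arcs. *)
Record crossing (arc : Type) := Crossing {
  positive : bool;
  over_in : arc;
  over_out : arc;
  under_in : arc;
  under_out : arc
}.

Definition diagram (m : nat) := m.-tuple (crossing 'I_m.*2).

(* The coefficient of an arc in each relation; contributions are summed, so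
   that coinciding arcs are accounted for. *)
Definition relation1 (arc : eqType) (c : crossing arc) (x : arc) : Zuv :=
  if positive c then
    (under_in c == x)%:R - (over_out c == x)%:R
    - pu * (under_out c == x)%:R + pu * (over_in c == x)%:R
  else
    (over_in c == x)%:R - (under_out c == x)%:R
    - pu * (over_out c == x)%:R + pu * (under_in c == x)%:R.

Definition relation2 (arc : eqType) (c : crossing arc) (x : arc) : Zuv :=
  if positive c then pv * (over_out c == x)%:R - (over_in c == x)%:R
  else pv * (over_in c == x)%:R - (over_out c == x)%:R.

Fact half_ord_proof (m : nat) (i : 'I_m.*2) : (i./2 < m)%N.
Proof. by rewrite ltn_half_double. Qed.

Definition half_ord (m : nat) (i : 'I_m.*2) : 'I_m :=
  Ordinal (half_ord_proof i).

(* Rows 2k and 2k+1 (0-based) are the two relations of crossing k. *)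
Definition alexander_matrix (m : nat) (D : diagram m) : 'M[Zuv]_m.*2 :=
  \matrix_(i, x)
    let c := tnth D (half_ord i) in
    if odd i then relation2 c x else relation1 c x.

Definition Delta0 (m : nat) (D : diagram m) : Zuv := \det (alexander_matrix D).

(* The quotient is taken in Frac; for diagrams of virtual knots it lies in
   Zuv by a theorem of Silver and Williams. *)
Definition Delta0bar (m : nat) (D : diagram m) : Frac :=
  tofrac (Delta0 D) / tofrac ((pu - 1) * (pv - 1) * (pu * pv - 1)).

Definition twist_length (a : seq int) : nat := (\sum_(x <- a) absz x)%N.

(* The classical crossings of the twist from left to right: (i, r) is the r-th
   crossing of block i, both 1-based. *)
Definition twist_positions (a : seq int) : seq (nat * nat) :=
  [seq (i, r) | i <- iota 1 (size a), r <- iota 1 (absz a`_i.-1)].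

Definition is_type1 (a : seq int) (i r : nat) : bool :=
  p (s a i.-1 + r%:Z - 1) == 0.

(* x_j is the ordinal j.-1 *)
Definition arc_x (a : seq int) (j : nat) : 'I_(twist_length a).+1.*2 :=
  inord j.-1.

Definition clasp (a : seq int) : crossing 'I_(twist_length a).+1.*2 :=
  let N := twist_length a in
  Crossing (p (s a (size a)) == 0)
    (arc_x a 2) (arc_x a 1) (arc_x a N.*2.+1) (arc_x a N.*2.+2).

(* The crossing c_(k+1), for 1 <= k <= twist_length a *)
Definition twist_crossing (a : seq int) (k : nat)
    : crossing 'I_(twist_length a).+1.*2 :=
  let: (i, r) := nth (0, 0)%N (twist_positions a) k.-1 in
  let pos := 0 < a`_i.-1 in
  let odd_in := arc_x a k.*2.-1 in
  let odd_out := arc_x a k.*2.+1 in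
  let even_in := arc_x a k.*2.+2 in
  let even_out := arc_x a k.*2 in
  if pos == is_type1 a i r then Crossing pos even_in even_out odd_in odd_out
  else Crossing pos odd_in odd_out even_in even_out.

(* Entry k is the crossing c_(k+1). *)
Definition VT (a : seq int) : diagram (twist_length a).+1 :=
  [tuple if k == 0 :> nat then clasp a else twist_crossing a k
     | k < (twist_length a).+1].

(* Main.v *)
Require Import Defs.
From HB Require Import structures.
From mathcomp Require Import all_boot all_order all_algebra.
From mathcomp Require Import ring zify.

Import Order.TTheory GRing.Theory Num.Theory.
Local Open Scope ring_scope.

(** At a twist crossing, the two relations express the pair of arcs on its right
    linearly through the pair [(x_odd, x_even)] on its left. Eliminating the
    arcs from left to right turns the determinant into the product of the
    2 x 2 determinants of the right-hand coefficients and of one 2 x 2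
    determinant, in which the clasp is combined with the composite of all
    these maps ([det_cyclic_blocks]).

    The maps are simultaneously triangular. In the coordinates [x = x_odd] and
    [d = x_even - x_odd], a crossing of type 1 is
    [(x, d) |-> (v x + (v - 1/u) d, d / u)] and one of type 2 is
    [(x, d) |-> (x / v, u d)]. So a twist acts by
    [(x, d) |-> (alpha x + beta d, gamma d)], where [alpha] and [gamma] are
    multiplicative in the word of crossing types, and the clasp determinant
    [closure_det] is affine in [beta], with coefficient [+-(u - 1)(v - 1)].

    Types alternate inside a block, and two consecutive crossings of a block
    compose to a pure shear: [alpha = gamma = 1] and [beta] equal to [uv - 1]
    or [1 - 1/(uv)]. Removing such a pair therefore keeps [alpha], [gamma] and
    the types of all other crossings, divides the product of determinants by
    [-uv], and shifts [beta]. A shear in block [i] contributes to the total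
    [beta] with the factor [gamma] of the blocks before it and the factor
    [alpha] of what follows it ([beta_block_word]). Multiplied by the
    determinants of the single crossings that remain in the odd blocks, these
    factors become the sign [(-1)^delta] and the power [(uv)^(eps i)]
    ([block_weight_eps]); the clasp contributes the sign [(-1)^(s n)]. *)

Set Implicit Arguments.
Unset Strict Implicit.
Unset Printing Implicit Defensive.

(** * Determinants of matrices of 2 x 2 blocks *)

Section BlockMatrices.
Variable R : comPzRingType.
Implicit Types F G : nat -> nat -> 'M[R]_2.

Definition parity_ord (k : nat) : 'I_2 := inord (odd k).

Lemma parity_ord_val (k : nat) : parity_ord k = odd k :> nat.
Proof. by rewrite inordK ?ltnS ?leq_b1. Qed.

(** Rows and columns come in consecutive pairs; [F i j] is the block on the
    pairs [i] and [j]. *)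
Definition bmx (m : nat) F : 'M[R]_m.*2 :=
  \matrix_(i, j) F i./2 j./2 (parity_ord i) (parity_ord j).

Lemma eq_bmx m F G :
  (forall i j, (i < m)%N -> (j < m)%N -> F i j = G i j) -> bmx m F = bmx m G.
Proof. by move=> e; apply/matrixP=> i j; rewrite !mxE e ?ltn_half_double. Qed.

Lemma sum_ord_double m (f : nat -> R) :
  \sum_(i < m.*2) f i = \sum_(i < m) (f i.*2 + f i.*2.+1).
Proof.
elim: m => [|m IHm]; first by rewrite !big_ord0.
by rewrite doubleS !big_ord_recr /= IHm addrA.
Qed.

Lemma mul_bmx m F G :
  bmx m F *m bmx m G = bmx m (fun i j => \sum_(k < m) F i k *m G k j).
Proof.
apply/matrixP=> i j; rewrite !mxE.
under eq_bigr do rewrite !mxE.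
rewrite (sum_ord_double m (fun k => F i./2 k./2 (parity_ord i) (parity_ord k) *
  G k./2 j./2 (parity_ord k) (parity_ord j))) summxE.
apply: eq_bigr => k _; rewrite !mxE !big_ord_recl big_ord0 addr0 /=.
rewrite uphalf_double doubleK.
have -> : parity_ord k.*2 = ord0.
  by apply: ord_inj; rewrite parity_ord_val odd_double.
have -> // : parity_ord k.*2.+1 = lift ord0 ord0.
by apply: ord_inj; rewrite parity_ord_val /= odd_double.
Qed.

Lemma ulsubmx_bmx m F : @ulsubmx R 2 m.*2 2 m.*2 (bmx m.+1 F) = F 0%N 0%N.
Proof.
apply/matrixP=> i j; rewrite !mxE /=.
have half0 (k : 'I_2) : k./2 = 0%N by case: k => [[|[]]].
have park (k : 'I_2) : parity_ord k = k.
  by apply: ord_inj; rewrite parity_ord_val; case: k => [[|[]]].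
by rewrite !half0 !park.
Qed.

Lemma drsubmx_bmx m F :
  @drsubmx R 2 m.*2 2 m.*2 (bmx m.+1 F) = bmx m (fun i j => F i.+1 j.+1).
Proof.
apply/matrixP=> i j; rewrite !mxE; congr (F _ _ _ _);
by apply: ord_inj; rewrite !parity_ord_val /= negbK.
Qed.

Lemma det_bmx_col0 m F : (forall i, (i < m)%N -> F i.+1 0%N = 0) ->
  \det (bmx m.+1 F) = \det (F 0%N 0%N) * \det (bmx m (fun i j => F i.+1 j.+1)).
Proof.
move=> F0; rewrite -[bmx m.+1 F](@submxK R 2 m.*2 2 m.*2) ulsubmx_bmx drsubmx_bmx.
suff -> : @dlsubmx R 2 m.*2 2 m.*2 (bmx m.+1 F) = 0
  by exact: (@det_ublock R 2 m.*2).
apply/matrixP=> i j; rewrite !mxE /=.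
have -> : j./2 = 0%N by case: j => [[|[]]].
by rewrite F0 ?mxE //; exact: half_ord_proof.
Qed.

Lemma det_bmx_row0 m F : (forall j, (j < m)%N -> F 0%N j.+1 = 0) ->
  \det (bmx m.+1 F) = \det (F 0%N 0%N) * \det (bmx m (fun i j => F i.+1 j.+1)).
Proof.
move=> F0; rewrite -[bmx m.+1 F](@submxK R 2 m.*2 2 m.*2) ulsubmx_bmx drsubmx_bmx.
suff -> : @ursubmx R 2 m.*2 2 m.*2 (bmx m.+1 F) = 0
  by exact: (@det_lblock R 2 m.*2).
apply/matrixP=> i j; rewrite !mxE /=.
have -> : i./2 = 0%N by case: i => [[|[]]].
by rewrite F0 ?mxE //; exact: half_ord_proof.
Qed.

Lemma det_bmx_lower m F :
  (forall i j, (i < j)%N -> F i j = 0) ->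
  \det (bmx m F) = \prod_(i < m) \det (F i i).
Proof.
elim: m F => [|m IHm] F F0; first by rewrite det_mx00 big_ord0.
rewrite det_bmx_row0 => [|j _]; last exact: F0.
by rewrite IHm ?big_ord_recl // => i j ij; apply: F0.
Qed.

(** The last block column meets the row of [C0], which closes the chain of the
    [A k] and [B k] into a cycle; for [m = 0] the entries [C0] and [C1] add up. *)
Definition cyclic_blocks (m : nat) (C0 C1 : 'M[R]_2) (A B : nat -> 'M[R]_2) :=
  fun i j : nat => match i with
  | 0 => C0 *+ (j == 0%N) + C1 *+ (j == m)
  | k.+1 => A k *+ (j == k) + B k *+ (j == k.+1)
  end.

(** The [P k] propagate the solution of the chain of relations from its first
    pair of unknowns. Adding to the first block column the others, multiplied
    by the [P k], clears it below its top block; what remains is lower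
    triangular. *)
Lemma det_cyclic_blocks m (C0 C1 : 'M[R]_2) (A B P : nat -> 'M[R]_2) :
    P 0%N = 1 -> (forall k, (k < m)%N -> A k *m P k + B k *m P k.+1 = 0) ->
  \det (bmx m.+1 (cyclic_blocks m C0 C1 A B)) =
    \det (C0 + C1 *m P m) * \prod_(k < m) \det (B k).
Proof.
move=> P0 PS; set F := cyclic_blocks _ _ _ _ _.
(* The matrix of the column operations, with determinant 1. *)
pose U i j := if j == 0%N then P i else 1 *+ (i == j).
have detU : \det (bmx m.+1 U) = 1.
  rewrite det_bmx_lower => [|i [|j]] //; last by rewrite /U /= => /ltn_eqF->.
  rewrite big1 // => [[[|i] /= _]] _; rewrite /U /= ?P0 ?det1 //.
  by rewrite eqxx det1.
rewrite -[LHS]mulr1 -{1}detU -det_mulmx mul_bmx.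
have colP (M : 'M[R]_2) (g : nat -> 'M[R]_2) k : (k < m.+1)%N ->
    \sum_(l < m.+1) (M *+ (l == k :> nat)) *m g l = M *m g k.
  move=> km; rewrite (bigD1 (Ordinal km)) //= eqxx big1 ?addr0 // => l.
  by rewrite -val_eqE /= => /negPf->; rewrite mul0mx.
have colU (g : nat -> 'M[R]_2) k : (k < m.+1)%N ->
    \sum_(l < m.+1) g l *m (1 *+ (l == k :> nat)) = g k.
  move=> km; rewrite (bigD1 (Ordinal km)) //= eqxx mulmx1 big1 ?addr0 // => l.
  by rewrite -val_eqE /= => /negPf->; rewrite mulmx0.
rewrite det_bmx_col0 => [|k km]; last first.
  under eq_bigr do rewrite mulmxDl.
  by rewrite big_split /= !colP ?PS // ltnS ltnW.
congr (_ * _).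
  under eq_bigr do rewrite mulmxDl.
  by rewrite big_split /= !colP // /U /= P0 mulmx1.
pose L i j := A i *+ (j.+1 == i) + B i *+ (j == i).
rewrite (_ : bmx m _ = bmx m L); last first.
  by apply: eq_bmx => i j im jm; rewrite /U colU.
rewrite det_bmx_lower => [|i j ij]; last first.
  by rewrite /L (gtn_eqF ij) (@gtn_eqF i j.+1 (ltnW ij)) addr0.
by apply: eq_bigr => i _; rewrite /L (gtn_eqF (ltnSn i)) eqxx add0r.
Qed.
End BlockMatrices.

(** * The relations of one crossing *)

Section Relations.
Variables (R : comNzRingType) (u v : R).
Implicit Types b : bool.

Definition mx2 (w x y z : R) : 'M[R]_2 :=
  \matrix_(i, j) if odd i then if odd j then z else y
                 else if odd j then x else w.

Lemma mx2P (A B : 'M[R]_2) :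
  A 0 0 = B 0 0 -> A 0 1 = B 0 1 -> A 1 0 = B 1 0 -> A 1 1 = B 1 1 -> A = B.
Proof.
have ord2 (i : 'I_2) : i = 0 \/ i = 1.
  by case: i => [[|[|i]]] // lti; [left | right]; apply: ord_inj.
move=> e00 e01 e10 e11; apply/matrixP=> i j.
by case: (ord2 i) => ->; case: (ord2 j) => ->.
Qed.

(** The coefficients of the relations of a twist crossing, of type 1 when [b]
    holds, on the arcs at its left and at its right. *)
Definition left_mx b := if b then mx2 1 (-1) 0 v else mx2 u (- u) (-1) 0.
Definition right_mx b := if b then mx2 (- u) u 0 (-1) else mx2 (-1) 1 v 0.
(** The coefficients of the relations of the clasp, positive when [b] holds, on
    the first and on the last pair of arcs. *)
Definition clasp_in_mx b := if b then mx2 (-1) u v (-1) else mx2 (- u) 1 (-1) v.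
Definition clasp_out_mx b := if b then mx2 1 (- u) 0 0 else mx2 u (-1) 0 0.

(** In [clasp_entry] and [twist_entry], the column [x] is the arc of parity
    [odd x] in its pair, and [b], [b'] say whether this pair is the one on
    which the first or the second matrix acts. The morphism [f] is there to
    pass from polynomials to their fractions. *)
Lemma clasp_entry (R0 : comNzRingType) (f : {rmorphism R0 -> R}) (u0 v0 : R0)
    (e b b' : bool) (i x : nat) :
  f u0 = u -> f v0 = v ->
  f (if odd i then
      if e then v0 * (~~ odd x && b)%:R - (odd x && b)%:R
      else v0 * (odd x && b)%:R - (~~ odd x && b)%:R
     else if e then
       (~~ odd x && b')%:R - (~~ odd x && b)%:R - u0 * (odd x && b')%:R
       + u0 * (odd x && b)%:R
     else
       (odd x && b)%:R - (odd x && b')%:R - u0 * (~~ odd x && b)%:R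
       + u0 * (~~ odd x && b')%:R)
  = (clasp_in_mx e *+ b + clasp_out_mx e *+ b') (parity_ord i) (parity_ord x).
Proof.
move=> hu hv; rewrite mxE !mulmxnE.
case: e; rewrite !mxE !parity_ord_val !oddb; case: (odd i);
  rewrite !(rmorphD, rmorphN, rmorphM, rmorph_nat) ?hu ?hv;
  case: (odd x); case: b; case: b' => /=; ring.
Qed.

Lemma twist_entry (R0 : comNzRingType) (f : {rmorphism R0 -> R}) (u0 v0 : R0)
    (e b b' : bool) (i x : nat) :
  f u0 = u -> f v0 = v ->
  f (if odd i then
      if e then v0 * (odd x && b)%:R - (odd x && b')%:R
      else v0 * (~~ odd x && b')%:R - (~~ odd x && b)%:R
     else if e then
       (~~ odd x && b)%:R - (odd x && b)%:R - u0 * (~~ odd x && b')%:R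
       + u0 * (odd x && b')%:R
     else
       (odd x && b')%:R - (~~ odd x && b')%:R - u0 * (odd x && b)%:R
       + u0 * (~~ odd x && b)%:R)
  = (left_mx e *+ b + right_mx e *+ b') (parity_ord i) (parity_ord x).
Proof.
move=> hu hv; rewrite mxE !mulmxnE.
case: e; rewrite !mxE !parity_ord_val !oddb; case: (odd i);
  rewrite !(rmorphD, rmorphN, rmorphM, rmorph_nat) ?hu ?hv;
  case: (odd x); case: b; case: b' => /=; ring.
Qed.

End Relations.

(** * The linear action of a twist *)

Section Twists.
Variables (K : fieldType) (u v : K).
Hypotheses (u0 : u != 0) (v0 : v != 0).
Implicit Types (b : bool) (t : seq bool).

Local Notation left_mx := (left_mx u v).
Local Notation right_mx := (right_mx u v).
Local Notation clasp_in_mx := (clasp_in_mx u v).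
Local Notation clasp_out_mx := (clasp_out_mx u).

(** The map [(x, d) |-> (al x + be d, ga d)], written in the coordinates
    [(x, x + d)] of the two strands. *)
Definition shear_mx (al be ga : K) : 'M[K]_2 :=
  mx2 (al - be) be (al - be - ga) (be + ga).

(** [alpha1], [beta1] and [gamma1] are the parameters of the map
    [- (right_mx b)^-1 *m left_mx b] in the form [shear_mx], and [weight1] is the
    determinant of [right_mx b]. *)
Definition alpha1 b := if b then v else v^-1.
Definition gamma1 b := if b then u^-1 else u.
Definition beta1 b := if b then v - u^-1 else 0.
Definition weight1 b := if b then u else - v.

Definition alpha t := \prod_(b <- t) alpha1 b.
Definition gamma t := \prod_(b <- t) gamma1 b.
Definition weight t := \prod_(b <- t) weight1 b.
(** The shear of a crossing reaches the end of the twist through the [alpha] of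
    the crossings after it, and its argument comes through the [gamma] of the
    crossings before it. *)
Fixpoint beta t : K :=
  if t is b :: t' then alpha t' * beta1 b + beta t' * gamma1 b else 0.

Definition twist_mx t := shear_mx (alpha t) (beta t) (gamma t).

Lemma alpha_cat t t' : alpha (t ++ t') = alpha t * alpha t'.
Proof. exact: big_cat. Qed.
Lemma gamma_cat t t' : gamma (t ++ t') = gamma t * gamma t'.
Proof. exact: big_cat. Qed.
Lemma weight_cat t t' : weight (t ++ t') = weight t * weight t'.
Proof. exact: big_cat. Qed.

Lemma alpha_cons b t : alpha (b :: t) = alpha1 b * alpha t.
Proof. exact: big_cons. Qed.
Lemma gamma_cons b t : gamma (b :: t) = gamma1 b * gamma t.
Proof. exact: big_cons. Qed.
Lemma weight_cons b t : weight (b :: t) = weight1 b * weight t.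
Proof. exact: big_cons. Qed.

Lemma beta_cat t t' : beta (t ++ t') = alpha t' * beta t + beta t' * gamma t.
Proof.
elim: t => [|b t IHt] /=.
  by rewrite mulr0 add0r /gamma big_nil mulr1.
by rewrite IHt alpha_cat gamma_cons; ring.
Qed.

Lemma twist_mx0 : twist_mx [::] = 1.
Proof.
rewrite /twist_mx /shear_mx /alpha /gamma !big_nil /=.
by apply: mx2P; rewrite !mxE /=; ring.
Qed.

Lemma twist_mx_step t b :
  left_mx b *m twist_mx t + right_mx b *m twist_mx (rcons t b) = 0.
Proof.
rewrite -cats1 /twist_mx alpha_cat gamma_cat beta_cat /= /alpha /gamma.
rewrite !big_seq1 !big_nil -/(alpha t) -/(gamma t).
by case: b; apply: mx2P; rewrite !mxE !big_ord_recl !big_ord0 !mxE /=; field.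
Qed.

Lemma det_mx2 (A : 'M[K]_2) : \det A = A 0 0 * A 1 1 - A 0 1 * A 1 0.
Proof.
rewrite (expand_det_row _ 0) !big_ord_recl big_ord0 /cofactor !det_mx11 !mxE /=.
rewrite (_ : lift ord0 ord0 = 1); last exact: ord_inj.
rewrite (_ : lift 1 0 = 0); last exact: ord_inj.
by ring.
Qed.

Lemma det_right_mx b : \det (right_mx b) = weight1 b.
Proof. by rewrite det_mx2; case: b; rewrite !mxE /=; ring. Qed.

(** The affine dependence on [beta] is what makes the final formula a sum over
    the removed pairs of crossings. *)
Definition closure_det b t :=
  if b then (u - 1) * (alpha t - 1) + (v - 1) * (u - 1) * beta t
            + (v - 1) * u * (gamma t - 1)
  else v * (u - 1) * (alpha t - 1) - (v - 1) * (u - 1) * beta t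
       + (v - 1) * (gamma t - 1).

Lemma det_closure b t :
  \det (clasp_in_mx b + clasp_out_mx b *m twist_mx t) = closure_det b t.
Proof.
by rewrite det_mx2; case: b; rewrite !mxE !big_ord_recl !big_ord0 !mxE /=; ring.
Qed.

Fixpoint alternating b (m : nat) : seq bool :=
  if m is m'.+1 then b :: alternating (~~ b) m' else [::].

(** The [beta] of two consecutive crossings, the first of type 1 when [b]
    holds; their [alpha] and [gamma] are 1. *)
Definition pair_shear b := (u * v - 1) * (if b then (u * v)^-1 else 1).

Lemma alpha_alternating b m :
  alpha (alternating b m) = alpha (alternating b (odd m)).
Proof.
elim/ltn_ind: m => [[|[|m]]] // IHm.
rewrite /= !negbK -IHm //= !alpha_cons; case: b {IHm} => /=; by field.
Qed.

Lemma gamma_alternating b m :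
  gamma (alternating b m) = gamma (alternating b (odd m)).
Proof.
elim/ltn_ind: m => [[|[|m]]] // IHm.
rewrite /= !negbK -IHm //= !gamma_cons; case: b {IHm} => /=; by field.
Qed.

Lemma weight_alternating b m :
  weight (alternating b m) = (- (u * v)) ^+ m./2 * weight (alternating b (odd m)).
Proof.
elim/ltn_ind: m => [[|[|m]]] IHm; rewrite ?mul1r //.
rewrite /= !negbK exprS -mulrA -IHm // !weight_cons; case: b {IHm} => /=; by ring.
Qed.

(** The removed pairs come first in the block, so that their shears are
    multiplied by the [alpha] of the crossing that may be left over. *)
Lemma beta_alternating b m :
  beta (alternating b m) = beta (alternating b (odd m))
    + m./2%:R * pair_shear b * alpha (alternating b (odd m)).
Proof.
elim/ltn_ind: m => [[|[|m]]] IHm; rewrite ?mul0r ?addr0 //.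
rewrite /= !negbK IHm // !alpha_cons.
rewrite alpha_alternating -[in RHS]natr1 /pair_shear.
by case: b {IHm} => /=; field; rewrite ?u0 ?v0.
Qed.

End Twists.

(** * The Alexander matrix of a virtual twist knot diagram *)

Definition twist_types (a : seq int) : seq bool :=
  [seq is_type1 a ir.1 ir.2 | ir <- twist_positions a].

Lemma size_twist_types a : size (twist_types a) = twist_length a.
Proof.
rewrite size_map size_allpairs_dep sumnE big_map /twist_length.
rewrite (iotaDl 1 0) big_map [RHS](big_nth 0) /index_iota subn0.
by apply: eq_bigr => i _; rewrite size_iota.
Qed.

Lemma twist_positionsP a i r : (i, r) \in twist_positions a ->
  [/\ (0 < i <= size a)%N & (0 < r <= absz (a`_i.-1)%R)%N].
Proof.
case/allpairsPdep=> [j [q []]]; rewrite !mem_iota !add1n !ltnS => jP qP [-> ->].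
by [].
Qed.

Lemma arc_x_eq a j (x : 'I_(twist_length a).+1.*2) :
  (j.-1 < (twist_length a).+1.*2)%N -> (arc_x a j == x) = (j.-1 == x :> nat).
Proof. by move=> jlt; rewrite -val_eqE /= inordK. Qed.

(** With zero-based indices, the arcs of pair [k] are the columns [k.*2] (odd
    strand) and [k.*2.+1] (even strand). *)
Lemma double_eq (k x : nat) : (k.*2 == x) = ~~ odd x && (x./2 == k).
Proof. by apply/eqP/andP=> [|[]]; lia. Qed.

Lemma doubleS_eq (k x : nat) : (k.*2.+1 == x) = odd x && (x./2 == k).
Proof. by apply/eqP/andP=> [|[]]; lia. Qed.

(** With nonnegative entries all twist crossings are positive, so that the type
    alone determines the relations of a crossing. *)
Lemma alexander_matrix_VT (a : seq int) : (forall i, 0 <= a`_i) ->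
  let m := twist_length a in
  let e := p (s a (size a)) == 0 in
  let t := twist_types a in
  map_mx (@tofrac _) (alexander_matrix (VT a)) =
  bmx m.+1 (cyclic_blocks m (clasp_in_mx fu fv e) (clasp_out_mx fu e)
     (fun k => left_mx fu fv (nth true t k))
     (fun k => right_mx fu fv (nth true t k))).
Proof.
move=> a_ge0 m e t; apply/matrixP=> i x; rewrite !mxE tnth_mktuple.
have lt_x := ltn_ord x; have lt_i := ltn_ord i.
rewrite -[half_ord i == 0 :> nat]/(i./2 == 0%N) -[nat_of_ord (half_ord i)]/(i./2).
case def_k: (i./2) => [|k] /=.
  rewrite /relation1 /relation2 /clasp -/m -/e /=.
  rewrite !arc_x_eq ?ltnS ?doubleS //=; try by rewrite -/m; lia.
  have x0 : (0%N == x) = ~~ odd x && (x./2 == 0%N) := double_eq 0 x.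
  have x1 : (1%N == x) = odd x && (x./2 == 0%N) := doubleS_eq 0 x.
  rewrite x0 x1 !double_eq !doubleS_eq.
  exact: (@clasp_entry _ fu fv _ (@tofrac _) pu pv).
have st : size (twist_positions a) = m.
  by rewrite -(size_map (fun ir => is_type1 a ir.1 ir.2)) size_twist_types.
have km : (k < m)%N by rewrite /m; lia.
rewrite (nth_map (0, 0)%N); last by rewrite st.
have : nth (0, 0)%N (twist_positions a) k \in twist_positions a.
  by rewrite mem_nth // st.
rewrite /twist_crossing /=; case: (nth _ _ _) => j r /twist_positionsP[_ rP] /=.
have -> : 0 < a`_j.-1.
  by move: rP; case: (a`_j.-1) (a_ge0 j.-1) => // -[|n] //=; lia.
rewrite /relation1 /relation2 -[true == _]/(is_type1 a j r).
case: (is_type1 a j r) => /=; clear - lt_i lt_x def_k km.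
all: rewrite !arc_x_eq; try by rewrite -/m; lia.
all: rewrite /= !double_eq !doubleS_eq.
exact: (@twist_entry _ fu fv _ (@tofrac _) pu pv true).
exact: (@twist_entry _ fu fv _ (@tofrac _) pu pv false).
Qed.

(** * Twists made of blocks *)

Section BlockWords.
Variables (K : fieldType) (u v : K).
Hypotheses (u0 : u != 0) (v0 : v != 0).
Variables (b : nat -> bool) (m : nat -> nat).

Definition block_word (f : nat -> nat) (n : nat) : seq bool :=
  flatten [seq alternating (b i) (f i) | i <- iota 1 n].

Local Notation reduced := (fun i => odd (m i) : nat).
Local Notation rest i := (alternating (b i) (odd (m i))).

Lemma block_wordS f n :
  block_word f n.+1 = block_word f n ++ alternating (b n.+1) (f n.+1).
Proof.
by rewrite /block_word -{1}[n.+1]addn1 iotaD map_cat flatten_cat /= cats0 add1n.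
Qed.

Lemma alpha_block_word n :
  alpha v (block_word m n) = alpha v (block_word reduced n).
Proof.
elim: n => // n IHn.
by rewrite !block_wordS !alpha_cat IHn (alpha_alternating v0).
Qed.

Lemma gamma_block_word n :
  gamma u (block_word m n) = gamma u (block_word reduced n).
Proof.
elim: n => // n IHn.
by rewrite !block_wordS !gamma_cat IHn (gamma_alternating u0).
Qed.

Lemma weight_block_word n :
  weight u v (block_word m n) =
    (- (u * v)) ^+ (\sum_(1 <= i < n.+1) (m i)./2)
    * weight u v (block_word reduced n).
Proof.
elim: n => [|n IHn]; first by rewrite big_nil mul1r.
rewrite !block_wordS !weight_cat IHn weight_alternating.
rewrite (big_nat_recr n.+1) //= exprD; ring.
Qed.

Lemma weight_gamma_block_word n :
  weight u v (block_word reduced n) * gamma u (block_word reduced n) =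
    \prod_(1 <= j < n.+1) (weight u v (rest j) * gamma u (rest j)).
Proof.
elim: n => [|n IHn]; first by rewrite /weight /gamma !big_nil mul1r.
by rewrite big_nat_recr //= -IHn !block_wordS weight_cat gamma_cat; ring.
Qed.

(** By induction on the number of blocks: appending a block multiplies the
    earlier shears by its [alpha], and adds its own shears, which act on what
    the [gamma] of the earlier blocks leaves. The factor [weight] is spread over
    the blocks because each of the products with [gamma] or [alpha] becomes a
    signed power of [uv]. *)
Lemma beta_block_word n :
  weight u v (block_word reduced n)
    * (beta u v (block_word m n) - beta u v (block_word reduced n)) =
  \sum_(1 <= i < n.+1) (m i)./2%:R * pair_shear u v (b i)
    * (\prod_(1 <= j < i) (weight u v (rest j) * gamma u (rest j))
       * \prod_(i <= j < n.+1) (weight u v (rest j) * alpha v (rest j))).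
Proof.
elim: n => [|n IHn]; first by rewrite big_nil subrr mulr0.
rewrite !block_wordS !beta_cat weight_cat gamma_block_word beta_alternating //.
rewrite [alpha v (alternating _ (m _))]alpha_alternating //.
rewrite [RHS]big_nat_recr //= big_nat1 -weight_gamma_block_word.
rewrite (eq_big_nat _ _ (F2 := fun i =>
    weight u v (rest n.+1) * alpha v (rest n.+1) * ((m i)./2%:R * pair_shear u v (b i)
     * (\prod_(1 <= j < i) (weight u v (rest j) * gamma u (rest j))
        * \prod_(i <= j < n.+1) (weight u v (rest j) * alpha v (rest j)))))).
  by rewrite -big_distrr /= -IHn; ring.
move=> i /andP[_ lein]; rewrite [X in _ * (_ * X)]big_nat_recr 1?ltnW //=; ring.
Qed.

Lemma closure_detB e t t' : alpha v t = alpha v t' -> gamma u t = gamma u t' ->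
  closure_det u v e t = closure_det u v e t'
    + (-1) ^+ (~~ e) * ((v - 1) * (u - 1)) * (beta u v t - beta u v t').
Proof. by rewrite /closure_det => -> ->; case: e => /=; ring. Qed.

End BlockWords.

(** * Nonzero elements of the field of fractions *)

Lemma fu_neq0 : fu != 0. Proof. by rewrite tofrac_eq0 polyX_eq0. Qed.
Lemma fv_neq0 : fv != 0. Proof. by rewrite tofrac_eq0 polyC_eq0 polyX_eq0. Qed.
Lemma fu1_neq0 : fu - 1 != 0.
Proof. by rewrite -tofrac1 -tofracB tofrac_eq0 polyXsubC_eq0. Qed.
Lemma fv1_neq0 : fv - 1 != 0.
Proof.
by rewrite -tofrac1 -tofracB tofrac_eq0 /pv -polyC1 -polyCB polyC_eq0 polyXsubC_eq0.
Qed.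
Lemma fufv1_neq0 : fu * fv - 1 != 0.
Proof.
rewrite -tofrac1 -tofracM -tofracB tofrac_eq0.
(* At u = 0 the polynomial uv - 1 takes the value -1. *)
apply/eqP => /(congr1 (horner^~ 0)); rewrite !hornerE /=.
by move/eqP; rewrite oppr_eq0 oner_eq0.
Qed.

(** * The determinant of the diagram *)

(** Elimination along the twist: the pairs of arcs are propagated by the
    composite maps of the initial segments of the twist. *)
Lemma Delta0_VT (a : seq int) : (forall i, 0 <= a`_i) ->
  tofrac (Delta0 (VT a)) = weight fu fv (twist_types a)
    * closure_det fu fv (p (s a (size a)) == 0) (twist_types a).
Proof.
move=> a_ge0; rewrite /Delta0 -det_map_mx alexander_matrix_VT //.
set t := twist_types a.
have st : size t = twist_length a by exact: size_twist_types.
rewrite (@det_cyclic_blocks _ _ _ _ _ _ (fun k => twist_mx fu fv (take k t))).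
- rewrite -st take_size det_closure mulrC; congr (_ * _).
  under eq_bigr do rewrite det_right_mx.
  by rewrite /weight (big_nth true) big_mkord.
- by rewrite take0 twist_mx0.
- move=> k km; rewrite (take_nth true) ?st //.
  exact: (twist_mx_step fu_neq0 fv_neq0).
Qed.

Lemma is_type1S a i r : is_type1 a i r.+1 = ~~ is_type1 a i r.
Proof. by rewrite /is_type1 /p; lia. Qed.

Lemma map_is_type1 a i r m :
  [seq is_type1 a i q | q <- iota r m] = alternating (is_type1 a i r) m.
Proof. by elim: m r => //= m IHm r; rewrite IHm is_type1S. Qed.

Lemma twist_types_block_word a : twist_types a =
  block_word (fun i => p (s a i.-1) == 0) (fun i => absz a`_i.-1) (size a).
Proof.
rewrite /twist_types /twist_positions map_flatten -map_comp; congr flatten.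
apply: eq_map => i /=; rewrite -map_comp.
have -> : (p (s a i.-1) == 0) = is_type1 a i 1.
  by rewrite /is_type1 addrK.
by rewrite -map_is_type1.
Qed.

(** * Signs and exponents *)

Lemma expfz_sum (K : fieldType) (z : K) (r : seq nat) (P : pred nat)
    (F : nat -> int) :
  z != 0 -> z ^ (\sum_(i <- r | P i) F i) = \prod_(i <- r | P i) z ^ F i.
Proof.
by move=> z0; apply: (big_morph (fun k => z ^ k)) => // x y; exact: expfzDr.
Qed.

Lemma sign_parity (K : fieldType) (x : int) : (-1 : K) ^ x = (-1) ^+ (p x != 0).
Proof.
rewrite {1}(divz_eq x 2) mulrC expfzDr ?oppr_eq0 ?oner_eq0 // -exprz_exp.
rewrite -[(-1) ^ 2]/((-1) ^+ 2) sqrrN expr1n exp1rz mul1r -/(p x).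
by have [->|->] : p x = 0 \/ p x = 1 by rewrite /p; lia.
Qed.

Lemma s_recr a i : s a i.+1 = s a i + (a`_i + 1).
Proof. by rewrite /s big_nat_recr. Qed.

Lemma p_map_p a i : p [seq p x | x <- a]`_i = p a`_i.
Proof.
have [lt_i | ge_i] := ltnP i (size a); last by rewrite !nth_default ?size_map.
by rewrite (nth_map 0) // /p; lia.
Qed.

Lemma p_s_map_p a i : p (s [seq p x | x <- a] i) = p (s a i).
Proof.
elim: i => [|i IHi]; first by rewrite /s !big_nil.
by rewrite !s_recr; move: IHi (p_map_p a i); rewrite /p; lia.
Qed.

Section Exponents.
Variables (K : fieldType) (u v : K).
Hypotheses (u0 : u != 0) (v0 : v != 0).

(** Here [x] stands for [s a j.-1] and [y] for the entry [a_j], so that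
    [x + (y + 1)] is [s a j]. A block of odd length leaves one crossing, of type
    1 if [x] is even and of type 2 otherwise. If it comes before the pair of
    crossings considered, its weight times its [gamma] is [1] for type 1 and
    [-uv] for type 2. *)
Lemma weight_gamma_rest (x y : int) :
  let t := alternating (p x == 0) (odd (absz y)) in
  weight u v t * gamma u t =
    (-1) ^ (p y * p (x + (y + 1))) * (u * v) ^ (p y * p (x + (y + 1))).
Proof.
move=> t; have [p_y | p_y] : p y = 0 \/ p y = 1 by rewrite /p; lia.
  have odd_y : odd (absz y) = false by move: p_y; rewrite /p; lia.
  by rewrite /t odd_y p_y !mul0r /weight /gamma !big_nil mul1r.
have odd_y : odd (absz y) by move: p_y; rewrite /p; lia.
have p_xy : p (x + (y + 1)) = p x by move: p_y; rewrite /p; lia.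
rewrite /t odd_y p_y p_xy !mul1r /weight /gamma /= !big_seq1.
have [->|->] : p x = 0 \/ p x = 1 by rewrite /p; lia.
  by rewrite /= !expr0z mulr1 mulfV.
by rewrite /= !expr1z; ring.
Qed.

(** If it comes after that pair, its weight times its [alpha] is [uv] for type 1
    and [-1] for type 2; in both positions, type 2 brings the sign. *)
Lemma weight_alpha_rest (x y : int) :
  let t := alternating (p x == 0) (odd (absz y)) in
  weight u v t * alpha v t =
    (-1) ^ (p y * p (x + (y + 1))) * (u * v) ^ (p y * p (1 + x)).
Proof.
move=> t; have [p_y | p_y] : p y = 0 \/ p y = 1 by rewrite /p; lia.
  have odd_y : odd (absz y) = false by move: p_y; rewrite /p; lia.
  by rewrite /t odd_y p_y !mul0r /weight /alpha !big_nil mul1r.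
have odd_y : odd (absz y) by move: p_y; rewrite /p; lia.
have p_xy : p (x + (y + 1)) = p x by move: p_y; rewrite /p; lia.
rewrite /t odd_y p_y p_xy !mul1r /weight /alpha /= !big_seq1.
have [p_x|p_x] : p x = 0 \/ p x = 1 by rewrite /p; lia.
  have -> : p (1 + x) = 1 by move: p_x; rewrite /p; lia.
  by rewrite p_x /= !expr0z expr1z mul1r.
have -> : p (1 + x) = 0 by move: p_x; rewrite /p; lia.
by rewrite p_x /= !expr0z expr1z mulNr mulfV ?mulr1.
Qed.

Lemma pair_shearE (x : int) :
  pair_shear u v (p x == 0) = (u * v - 1) * (u * v) ^ (p x - 1).
Proof.
by rewrite /pair_shear; have [->|->] : p x = 0 \/ p x = 1 by rewrite /p; lia.
Qed.

(** This is the origin of [eps]: its first term comes from [pair_shearE], its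
    second counts the crossings of type 2 left over before the pair, and its
    third those of type 1 left over after it. Every crossing of type 2 left over
    brings a sign, hence [delta]. *)
Lemma block_weight_eps (a : seq int) (i : nat) : (0 < i <= size a)%N ->
  let rest j := alternating (p (s a j.-1) == 0) (odd (absz a`_j.-1)) in
  (u * v) ^ (p (s a i.-1) - 1)
  * (\prod_(1 <= j < i) (weight u v (rest j) * gamma u (rest j))
     * \prod_(i <= j < (size a).+1) (weight u v (rest j) * alpha v (rest j)))
  = (-1) ^ delta a * (u * v) ^ eps a i.
Proof.
move=> /andP[i_gt0 i_le] rest; have uv0 : u * v != 0 by rewrite mulf_neq0.
have N10 : (-1 : K) != 0 by rewrite oppr_eq0 oner_eq0.
rewrite (eq_big_nat _ _ (F2 := fun j => (-1) ^ (p a`_j.-1 * p (s a j))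
  * (u * v) ^ (p a`_j.-1 * p (s a j)))); last first.
  by move=> [|j] // _; rewrite s_recr; exact: weight_gamma_rest.
rewrite [X in _ * (_ * X)](eq_big_nat _ _ (F2 := fun j =>
  (-1) ^ (p a`_j.-1 * p (s a j)) * (u * v) ^ (p a`_j.-1 * p (1 + s a j.-1)))); last first.
  move=> [|j] /andP[ij _]; first by move: i_gt0; rewrite ltnNge ij.
  by rewrite s_recr; exact: weight_alpha_rest.
rewrite /eps !(expfzDr _ _ uv0) /delta [X in (-1) ^ X](big_cat_nat i_gt0) /=.
  by rewrite (expfzDr _ _ N10) !expfz_sum // !big_split /=; ring.
by rewrite ltnW.
Qed.

(** The result in any field in which the denominators make sense; the
    polynomial part of the argument is confined to [Delta0_VT]. *)
Lemma closure_reduction (a : seq int) :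
    u - 1 != 0 -> v - 1 != 0 -> u * v - 1 != 0 -> (forall i, 0 <= a`_i) ->
  let b i := p (s a i.-1) == 0 in
  let m i := absz a`_i.-1 in
  let n := size a in
  let e := p (s a n) == 0 in
  let t := block_word b m n in
  let t' := block_word b (fun i => odd (m i)) n in
  let den := (u - 1) * (v - 1) * (u * v - 1) in
  weight u v t * closure_det u v e t / den =
    (- (u * v)) ^ (\sum_(1 <= i < n.+1) (a`_i.-1 %/ 2)%Z)
    * (weight u v t' * closure_det u v e t' / den
       + \sum_(1 <= i < n.+1)
           (a`_i.-1 %/ 2)%Z%:~R * (-1) ^ (delta a + s a n) * (u * v) ^ (eps a i)).
Proof.
move=> u1 v1 uv1 a_ge0 b m n e t t' den.
have half_a i : (a`_i.-1 %/ 2)%Z = (m i)./2 :> int.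
  by rewrite /m; move: (a_ge0 i.-1); lia.
have -> : \sum_(1 <= i < n.+1)
      (a`_i.-1 %/ 2)%Z%:~R * (-1) ^ (delta a + s a n) * (u * v) ^ eps a i =
    (-1) ^+ (~~ e) / (u * v - 1)
      * (weight u v t' * (beta u v t - beta u v t')).
  rewrite beta_block_word // big_distrr /=; apply: eq_big_nat => i i_n.
  have E := block_weight_eps i_n.
  have N10 : (-1 : K) != 0 by rewrite oppr_eq0 oner_eq0.
  rewrite half_a (expfzDr _ _ N10) (sign_parity _ (s a n)) pair_shearE -/n -/e.
  transitivity ((-1) ^+ (~~ e) * (m i)./2%:R * ((-1) ^ delta a * (u * v) ^ eps a i)).
    by rewrite -pmulrn; ring.
  by rewrite -E; field.
rewrite (closure_detB e (alpha_block_word v0 b m n) (gamma_block_word u0 b m n)).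
rewrite weight_block_word (eq_bigr _ (fun i _ => half_a i)).
rewrite -(big_morph Posz PoszD (erefl 0%Z)) -exprnP.
by rewrite /den; field; rewrite u1 v1 uv1.
Qed.

End Exponents.

(** * The reduction formula *)

Theorem theorem2 (n : nat) (a : n.-tuple int)
    (hn : (1 <= n)%N) (ha : forall i : 'I_n, 0 <= tnth a i) :
  Delta0bar (VT a) =
    (- (fu * fv)) ^ (\sum_(1 <= i < n.+1) (a`_i.-1 %/ 2)%Z)
    * (Delta0bar (VT [seq p x | x <- a])
       + \sum_(1 <= i < n.+1)
           (a`_i.-1 %/ 2)%Z%:~R * (-1) ^ (delta a + s a n)
           * (fu * fv) ^ (eps a i)).
Proof.
have a_ge0 i : 0 <= a`_i.
  have [lt_i | ge_i] := ltnP i n; last by rewrite nth_default ?size_tuple.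
  by have := ha (Ordinal lt_i); rewrite (tnth_nth 0).
have pa_ge0 i : 0 <= [seq p x | x <- a]`_i.
  have [lt_i | ge_i] := ltnP i (size a); last by rewrite nth_default ?size_map.
  by rewrite (nth_map 0) // /p; lia.
have := closure_reduction fu_neq0 fv_neq0 fu1_neq0 fv1_neq0 fufv1_neq0 a_ge0.
rewrite /Delta0bar !Delta0_VT // !tofracM !tofracB !tofracM !tofrac1 -/fu -/fv.
rewrite !twist_types_block_word size_map size_tuple p_s_map_p /=.
suff -> : block_word (fun i => p (s [seq p x | x <- a] i.-1) == 0)
      (fun i => absz [seq p x | x <- a]`_i.-1) n =
    block_word (fun i => p (s a i.-1) == 0) (fun i => odd (absz a`_i.-1)) n by [].
congr flatten; apply: eq_map => i; rewrite p_s_map_p; congr alternating.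
have := p_map_p a i.-1; have := a_ge0 i.-1; have := pa_ge0 i.-1.
have [lt_i | ge_i] := ltnP i.-1 (size a); last by rewrite !nth_default ?size_map.
by rewrite (nth_map 0) // /p; lia.
Qed.
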